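(* Let $z\in\mathbb C^*=\mathbb C\setminus\{0\}$ and $t=z\bar z$. Let $M_z=\{M_z^{(n)}\}$ be the coherent system of the character $\chi_z$. For any $n\ge1$ and any Young diagram $\lambda$ with $n$ boxes, $$M_z^{(n)}(\lambda)=\frac{\prod_{b\in\lambda}|z+c(b)|^2}{t(t+1)\cdots(t+n-1)}\cdot\frac{\dim^2\lambda}{n!}.$$
   Context: $S(n)$ is the group of permutations of $\{1,\dots,n\}$, identified with the stabilizer of $n+1$ in $S(n+1)$; $S(\infty)=\bigcup_n S(n)$; $G=S(\infty)\times S(\infty)$, $G(n)=S(n)\times S(n)$. The canonical projection $p_{n,n+1}:S(n+1)\to S(n)$ removes $n+1$ from its cycle: for $1\le i\le n$, $(p_{n,n+1}(x))(i)=x(i)$ if $x(i)\le n$, and $=x(n+1)$ if $x(i)=n+1$. $\mathfrak S=\varprojlim S(n)$ is the compact space of sequences $x=(x_n)$, $x_n\in S(n)$, with $p_{n,n+1}(x_{n+1})=x_n$. $G$ acts on $\mathfrak S$ on the right: for $g=(g_1,g_2)$, $x\cdot g=y$ where $y_n=g_2^{-1}x_ng_1$ for all $n$ with $g\in G(n)$. For $s\in S(n)$, $[s]$ is the number of cycles of $s$. $c(x,g)=[(x\cdot g)_n]-[x_n]\in\mathbb Z$ for any $n$ with $g\in G(n)$ (independent of such $n$). $\mu_t$ is the Borel probability measure on $\mathfrak S$ whose image on each $S(n)$ has weights $\dfrac{t^{[s]}}{t(t+1)\cdots(t+n-1)}$. The representation $T_z$ of $G$ acts in $L^2(\mathfrak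 S,\mu_t)$ by $(T_z(g)f)(x)=f(x\cdot g)z^{c(x,g)}$. Its distinguished vector is the function $f_0\equiv1$. The corresponding spherical function is $\varphi_z(g)=(T_z(g)f_0,f_0)$, $g\in G$, and the character is $\chi_z(s)=\varphi_z(s,e)$, $s\in S(\infty)$ (a central positive definite function with $\chi_z(e)=1$). For a Young diagram $\lambda$ with $n$ boxes, $\chi^\lambda$ is the corresponding irreducible character of $S(n)$ and $\dim\lambda=\chi^\lambda(e)$. The coherent system $\{M_z^{(n)}\}$ of $\chi_z$ consists of the probability distributions $M_z^{(n)}$ on the set of Young diagrams with $n$ boxes defined by $$\chi_z|_{S(n)}=\sum_{|\lambda|=n}M_z^{(n)}(\lambda)\frac{\chi^\lambda}{\dim\lambda}.$$ For a box $b=(i,j)$ of $\lambda$ (row $i$, column $j$), $c(b)=j-i$ is its content. *)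

(* Defs.v *)
From HB Require Import structures.
From mathcomp Require Import all_boot all_order all_algebra all_fingroup.
From mathcomp Require Import mxrepresentation.
From mathcomp Require Import all_classical all_reals all_analysis.
From mathcomp Require Import complex.

Set Implicit Arguments.
Unset Strict Implicit.
Unset Printing Implicit Defensive.

Import Order.TTheory GRing.Theory Num.Theory.

(** Points, rows and columns are numbered from 0, and [S(n)] is ['S_n].  The
    product of ['S_n] is left-to-right, [(s * t) i = t (s i)]: the permutation
    written [g2^-1 x g1] with right-to-left composition is [g1 * x * g2^-1]. *)

Definition fixes_from (n : nat) (f : nat -> nat) : Prop :=
  forall i : nat, (n <= i)%N -> f i = i.

(** [S(oo)], the union of the [S(n)]: the finitary permutations of [nat]. *)
Record Sinf := MkSinf {
  Sinf_fun :> nat -> nat;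
  Sinf_bij : bijective Sinf_fun;
  Sinf_fin : exists n, fixes_from n Sinf_fun
}.

Fact id_fixes_from : exists n, fixes_from n (@id nat).
Proof. by exists 0%N. Qed.

Definition Sinf1 : Sinf :=
  MkSinf (Bijective (fun _ => erefl) (fun _ => erefl)) id_fixes_from.

Definition extend n (s : 'S_n) (i : nat) : nat :=
  if insub i is Some j then val (s j) else i.

Lemma extend_ord n (s : 'S_n) (i : 'I_n) : extend s i = s i.
Proof. by rewrite /extend valK. Qed.

Lemma extend_ge n (s : 'S_n) : fixes_from n (extend s).
Proof. by move=> i le_ni; rewrite /extend insubF // ltnNge le_ni. Qed.

Lemma extendK n (s : 'S_n) : cancel (extend s) (extend (s^-1)%g).
Proof.
move=> i; case: (ltnP i n) => [lt_in | le_ni]; last by rewrite !extend_ge.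
by rewrite (_ : i = val (Ordinal lt_in)) // !extend_ord permK.
Qed.

Lemma extend_bij n (s : 'S_n) : bijective (extend s).
Proof.
exists (extend (s^-1)%g); first exact: extendK.
by have := extendK (s^-1)%g; rewrite invgK.
Qed.

Definition Sinf_of n (s : 'S_n) : Sinf :=
  MkSinf (extend_bij s) (ex_intro _ n (@extend_ge n s)).

(** The permutation of ['I_n] induced by [g], for [g] in [S(n)]; it has the
    junk value [1] when [g] does not preserve [{0, ..., n-1}]. *)
Definition restrict n (g : Sinf) : 'S_n :=
  insubd (1%g : 'S_n) [ffun i : 'I_n => insubd i (g i)].

Lemma restrictE n (g : Sinf) (i : 'I_n) :
  fixes_from n g -> restrict n g i = g i :> nat.
Proof.
move=> gn; have g_inj : injective g := bij_inj (Sinf_bij g).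
have g_lt (j : 'I_n) : (g j < n)%N.
  rewrite ltnNge; apply/negP => le_ngj; have := ltn_ord j.
  by have /g_inj <- := gn _ le_ngj; rewrite ltnNge le_ngj.
have valE (j : 'I_n) : insubd j (g j) = g j :> nat.
  by rewrite val_insubd g_lt.
have g'_inj : injectiveb [ffun j : 'I_n => insubd j (g j)].
  apply/injectiveP => j k; rewrite !ffunE => /(congr1 (@nat_of_ord n)).
  by rewrite !valE => /g_inj/val_inj.
by rewrite -pvalE [pval _]val_insubd g'_inj ffunE valE.
Qed.

Definition Ginf : Type := (Sinf * Sinf)%type.

Definition in_G (n : nat) (g : Ginf) : Prop :=
  fixes_from n g.1 /\ fixes_from n g.2.

Lemma in_GW m n (g : Ginf) : (m <= n)%N -> in_G m g -> in_G n g.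
Proof.
move=> le_mn [g1m g2m].
by split=> i le_ni; [apply: g1m|apply: g2m]; apply: leq_trans le_ni.
Qed.

Lemma ex_in_G (g : Ginf) : exists n, `[< in_G n g >].
Proof.
case: g => g1 g2; have [n1 g1n] := Sinf_fin g1; have [n2 g2n] := Sinf_fin g2.
exists (maxn n1 n2); apply/asboolP; split=> i; rewrite geq_max => /andP[? ?].
  exact: g1n.
exact: g2n.
Qed.

Definition level (g : Ginf) : nat := ex_minn (ex_in_G g).

Lemma in_G_level (g : Ginf) n : (level g <= n)%N -> in_G n g.
Proof.
rewrite /level; case: ex_minnP => m /asboolP gm _ le_mn; exact: in_GW gm.
Qed.

(** [proj] is the canonical projection [S(n+1) -> S(n)]; the removed point is
    [ord_max], and ['I_n] embeds into ['I_n.+1] by [lift ord_max]. *)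
Definition skip_max n (s : 'S_n.+1) (i : 'I_n) : 'I_n.+1 :=
  let j := s (lift ord_max i) in if j == ord_max then s ord_max else j.

Lemma skip_max_neq n (s : 'S_n.+1) (i : 'I_n) : ord_max != skip_max s i.
Proof.
rewrite /skip_max; case: (eqVneq (s _) ord_max) => [si|]; last by rewrite eq_sym.
apply/eqP => sm; have := neq_lift ord_max i.
by rewrite -(inj_eq (@perm_inj _ s)) si => /eqP[].
Qed.

Definition proj_fun n (s : 'S_n.+1) (i : 'I_n) : 'I_n :=
  odflt i (unlift ord_max (skip_max s i)).

Lemma lift_proj_fun n (s : 'S_n.+1) (i : 'I_n) :
  lift ord_max (proj_fun s i) = skip_max s i.
Proof.
by rewrite /proj_fun; case: (unlift_some (skip_max_neq s i)) => j -> ->.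
Qed.

Lemma proj_fun_inj n (s : 'S_n.+1) : injective (proj_fun s).
Proof.
move=> i j /(congr1 (lift ord_max)); rewrite !lift_proj_fun /skip_max.
have lm k : lift ord_max k == ord_max = false :> bool.
  by rewrite eq_sym; apply/negbTE/neq_lift.
case: eqP => [si|_]; case: eqP => [sj|_].
- by move=> _; apply/(@lift_inj _ ord_max)/(@perm_inj _ s); rewrite si sj.
- by move=> /perm_inj/eqP; rewrite eq_sym lm.
- by move=> /perm_inj/eqP; rewrite lm.
- by move=> /perm_inj/lift_inj.
Qed.

Definition proj n (s : 'S_n.+1) : 'S_n := perm (@proj_fun_inj n s).

Lemma projE n (s : 'S_n.+1) (i : 'I_n) :
  lift ord_max (proj s i) = skip_max s i.
Proof. by rewrite permE lift_proj_fun. Qed.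

(** The projective limit of the [S(n)]; the trivial level [n = 0] is included.
    Its topology is induced by the product of the discrete topologies. *)
Definition vperm : topologicalType :=
  set_type [set x : prod_topology (fun n => discrete_topology 'S_n) |
            forall n, proj (x n.+1) = x n]%classic.

Definition vcoord (x : vperm) (n : nat) : 'S_n := \val x n.

Lemma proj_vcoord (x : vperm) n : proj (vcoord x n.+1) = vcoord x n.
Proof. exact: (set_mem (valP x)). Qed.

Definition mk_vperm (x : forall n, 'S_n)
  (px : forall n, proj (x n.+1) = x n) : vperm := exist _ x (mem_set px).

Lemma proj1 n : proj (1%g : 'S_n.+1) = 1%g.
Proof.
apply/permP => i; apply: (@lift_inj _ ord_max).
by rewrite projE /skip_max !perm1 eq_sym (negbTE (neq_lift _ _)).
Qed.

HB.instance Definition _ := isPointed.Build vperm (mk_vperm proj1).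

Definition borel_vperm := g_sigma_algebraType (@open vperm).

Lemma restrict_lift n (g : Sinf) :
  fixes_from n g -> restrict n.+1 g = lift_perm ord_max ord_max (restrict n g).
Proof.
move=> gn; have gn1 : fixes_from n.+1 g by move=> i /ltnW; exact: gn.
apply/permP => i; apply/ord_inj; rewrite restrictE //.
case: (unliftP ord_max i) => [j|] ->; last by rewrite lift_perm_id /= gn.
by rewrite lift_perm_lift !lift_max restrictE.
Qed.

Lemma proj_translate n (a b : 'S_n) (s : 'S_n.+1) :
  proj (lift_perm ord_max ord_max a * s * lift_perm ord_max ord_max b)%g =
  (a * proj s * b)%g.
Proof.
apply/permP => i; apply: (@lift_inj _ ord_max); rewrite projE /skip_max.
rewrite !permM lift_perm_lift lift_perm_id -(lift_perm_lift ord_max ord_max b).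
rewrite projE /skip_max; set u := s _.
have -> : (lift_perm ord_max ord_max b u == ord_max) = (u == ord_max).
  by rewrite -(inj_eq (@perm_inj _ (lift_perm ord_max ord_max b)) u) lift_perm_id.
by case: ifP.
Qed.

(** [g2^-1 x_n g1], meaningful when [g] belongs to [G(n)]. *)
Definition translate (x : vperm) (g : Ginf) (n : nat) : 'S_n :=
  (restrict n g.1 * vcoord x n * (restrict n g.2)^-1)%g.

Lemma proj_translateE x (g : Ginf) n :
  in_G n g -> proj (translate x g n.+1) = translate x g n.
Proof.
move=> [g1n g2n]; rewrite /translate !restrict_lift // lift_permV.
by rewrite proj_translate proj_vcoord.
Qed.

(** The image in [S(n)] of the permutation [g2^-1 x_m g1], [m = n + k]. *)
Fixpoint act_from (x : vperm) (g : Ginf) (k n : nat) : 'S_n :=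
  if k is k'.+1 then proj (act_from x g k' n.+1) else translate x g n.

Lemma act_fromS x (g : Ginf) k n :
  in_G (n + k) g -> act_from x g k.+1 n = act_from x g k n.
Proof.
elim: k n => [|k IHk] n; first by rewrite addn0; exact: proj_translateE.
by rewrite -addSnnS => /IHk /= ->.
Qed.

Fact act_subproof x (g : Ginf) n :
  proj (act_from x g (level g) n.+1) = act_from x g (level g) n.
Proof. exact/act_fromS/in_G_level/leq_addl. Qed.

(** [x . g] is obtained by projecting [g2^-1 x_m g1] from a level [m] with [g]
    in [G(m) = S(m) x S(m)]; [vcoord_act] is the defining property of the
    action. *)
Definition vact (x : vperm) (g : Ginf) : vperm := mk_vperm (act_subproof x g).

Lemma vcoord_act x (g : Ginf) n :
  in_G n g -> vcoord (vact x g) n = translate x g n.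
Proof.
move=> gn; rewrite /vcoord /=; elim: (level g) => [//|k IHk].
by rewrite act_fromS //; apply: in_GW gn; exact: leq_addr.
Qed.

(** Fixed points count as cycles. *)
Definition ncycles n (s : 'S_n) : nat := #|porbits s|.

Local Open Scope ring_scope.
Local Open Scope complex_scope.

(** The difference does not depend on the choice of [n] with [g] in [G(n)];
    the least such [n] is used. *)
Definition cocycle (x : vperm) (g : Ginf) : int :=
  (ncycles (vcoord (vact x g) (level g)))%:Z - (ncycles (vcoord x (level g)))%:Z.

Definition rising (K : pzRingType) (t : K) (n : nat) : K :=
  \prod_(k < n) (t + k%:R).

(** This characterizes the Borel probability measure [mu_t]. *)
Definition is_ewens (R : realType) (t : R) (mu : probability borel_vperm R) :
    Prop :=
  forall (n : nat) (s : 'S_n), (0 < n)%N ->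
    mu [set x : vperm | vcoord x n = s]%classic =
      (t ^+ ncycles s / rising t n)%:E.

Definition cintegral (R : realType) (mu : probability borel_vperm R)
    (f : vperm -> R[i]) : R[i] :=
  (\int[mu]_(x in [set: borel_vperm]) complex.Re (f x))%R +i*
  (\int[mu]_(x in [set: borel_vperm]) complex.Im (f x))%R.

(** The inner product of [L^2(mu)], on representatives. *)
Definition inner (R : realType) (mu : probability borel_vperm R)
    (f h : vperm -> R[i]) : R[i] :=
  cintegral mu (fun x => f x * (h x)^*).

Definition Trep (R : realType) (z : R[i]) (g : Ginf) (f : vperm -> R[i]) :
    vperm -> R[i] :=
  fun x => f (vact x g) * z ^ cocycle x g.

Definition distinguished (R : realType) : vperm -> R[i] := fun _ => 1.

Definition spherical (R : realType) (mu : probability borel_vperm R)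
    (z : R[i]) (g : Ginf) : R[i] :=
  inner mu (Trep z g (@distinguished R)) (@distinguished R).

Definition chi (R : realType) (mu : probability borel_vperm R)
    (z : R[i]) (s : Sinf) : R[i] :=
  spherical mu z (s, Sinf1).

(** A Young diagram with [n] boxes fits into an [n x n] square; it is the set
    of its boxes [(i, j)] (row, column), numbered from 0. *)
Definition is_young n (A : {set 'I_n * 'I_n}) : bool :=
  (#|A| == n) &&
  [forall b in A, forall c : 'I_n * 'I_n,
     (c.1 <= b.1)%N && (c.2 <= b.2)%N ==> (c \in A)].

Definition young n : Type := {A : {set 'I_n * 'I_n} | is_young A}.

Definition box_content n (b : 'I_n * 'I_n) : int := (b.2)%:Z - (b.1)%:Z.

Fact card_young n (l : young n) : n = #|val l|.
Proof. by case: l => A /= /andP[/eqP]. Qed.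

(** The standard tableau that numbers the boxes row by row. *)
Definition tableau n (l : young n) (k : 'I_n) : 'I_n * 'I_n :=
  enum_val (cast_ord (card_young l) k).

Definition row_stab n (l : young n) : {set 'S_n} :=
  [set p : 'S_n | [forall k, (tableau l (p k)).1 == (tableau l k).1]].

Definition col_stab n (l : young n) : {set 'S_n} :=
  [set q : 'S_n | [forall k, (tableau l (q k)).2 == (tableau l k).2]].

(** The Young symmetrizer [sum_(p, q) sgn(q) (p o q)], as a row vector of the
    group algebra; [p o q] is [q * p] in the left-to-right convention. *)
Definition young_sym (F : fieldType) n (l : young n) :
    'rV[F]_#|[set: 'S_n]%G| :=
  \sum_(p in row_stab l) \sum_(q in col_stab l)
     (-1) ^+ odd_perm q *: delta_mx 0 (gring_index [set: 'S_n]%G (q * p)%g).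

(** The Specht representation: the ideal of the group algebra generated by the
    Young symmetrizer.  It is a left ideal for right-to-left composition, i.e.
    a right ideal for the product of ['S_n]. *)
Definition specht (F : fieldType) n (l : young n) :=
  submod_repr (cyclic_mx_module (regular_repr F [set: 'S_n]%G) (young_sym F l)).

Definition irr_char (F : fieldType) n (l : young n) (s : 'S_n) : F :=
  \tr (specht F l s).

Definition irr_dim (F : fieldType) n (l : young n) : F := irr_char F l 1%g.

Definition is_coherent_system (R : realType) (f : Sinf -> R[i])
    (M : forall n, young n -> R) : Prop :=
  forall n : nat, (0 < n)%N ->
    [/\ forall l : young n, 0 <= M n l,
        \sum_(l : young n) M n l = 1
      & forall s : 'S_n,
          f (Sinf_of s) =
          \sum_(l : young n)
             (M n l)%:C * (irr_char R[i] l s / irr_dim R[i] l)].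

(* Main.v *)
Require Import Defs.
From mathcomp Require Import all_boot all_order all_algebra all_fingroup.
From mathcomp Require Import mxrepresentation.
From mathcomp Require Import all_classical all_reals all_analysis.
From mathcomp Require Import complex.
From mathcomp Require Import zify ring.

Set Implicit Arguments.
Unset Strict Implicit.
Unset Printing Implicit Defensive.

Import Order.TTheory GRing.Theory Num.Theory.
Local Open Scope ring_scope.
Local Open Scope complex_scope.

(** Let [A_z] be the sum of [z^[x] x] over all [x] in [S(n)]: a central element
    of the group algebra.  Since [t^[x] = z^[x] (conj z)^[x]] and the cocycle
    may be computed at level [n], integrating over the cylinders of level [n]
    shows that, up to the factor [t(t+1)...(t+n-1)], the value [chi_z(s)] is the
    sum over [x] of [z^[sx] (conj z)^[x]], that is, a coefficient of
    [A_z A_(conj z)] ([chi_Sinf_of]).  The theorem follows by extending [chi_z]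
    linearly to the group algebra and evaluating it in two ways at the Young
    symmetrizer [y], the sum of [sgn(q) q p] over the column permutations [q]
    and the row permutations [p] of a tableau of shape [lambda].

    On the one hand, [A_z y = omega(z) y] where [omega(z)] is the product of the
    [z + c(b)] ([young_coef_conv_cycles]), and the coefficient of [y] at the
    identity is [1]; hence [chi_z(y)] is [omega(z) omega(conj z)] divided by
    the rising factorial ([young_coef_cycle_pairing]).  Two facts give the
    eigenvalue.  By von Neumann's lemma ([col_row_equivariantE]), an element on
    which column permutations act on the left by their sign and row permutations
    act trivially on the right is a multiple of [y]; this applies to [A_z y],
    so [omega(z)] is its coefficient at the identity, the sum of
    [sgn(q) z^[qp]].  That sum is built up from [z^n] for the empty diagram by
    adding corners one at a time, each corner [b] contributing a factor
    [1 + c(b) / z] ([cycle_sum_corner]); this is the Jucys-Murphy factorization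
    of [A_z], read through the effect of a transposition on the number of
    cycles.

    On the other hand, the coherent system expresses [chi_z(y)] through the
    traces of [y] in the Specht modules.  For a shape other than [lambda] the
    trace vanishes: [A_z] acts by a scalar on either side, and the two scalars
    differ for some [z] because the multiset of contents determines the diagram
    ([young_trace_neq], [young_eq_diagonal]).  For [lambda] itself von Neumann's
    lemma gives [y x y] proportional to [y] for all [x]; so [y] acts with rank
    one and trace [k], where [y y = k y], and comparing the trace and the rank
    of the multiplication by [y] on the whole group algebra gives
    [k dim(lambda) = n!] ([young_trace_dim]).  Hence [chi_z(y)] is
    [M(lambda) k / dim(lambda) = M(lambda) n! / dim(lambda)^2], to be equated
    with [|omega(z)|^2] over the rising factorial.

    Products of permutations are read from left to right. *)

(** * Permutations preserving the fibres of a map *)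

Section FiberStabilizer.
Variables (T : finType) (I : eqType) (f : T -> I).
Implicit Types (D : {set T}) (p : {perm T}).

Definition fiber_stab D : {set {perm T}} :=
  [set p | perm_on D p & [forall k, f (p k) == f k]].

Lemma fiber_stabP D p :
  reflect (perm_on D p /\ forall k, f (p k) = f k) (p \in fiber_stab D).
Proof.
by rewrite inE; apply: (iffP andP) => -[pD] => [/eqfunP|] pf; split=> //;
  apply/eqfunP.
Qed.

Lemma group_set_fiber_stab D : group_set (fiber_stab D).
Proof.
apply/group_setP; split=> [|p q /fiber_stabP[pD pf] /fiber_stabP[qD qf]].
  by apply/fiber_stabP; split=> [|k]; rewrite ?perm_on1 ?perm1.
by apply/fiber_stabP; split=> [|k]; rewrite ?perm_onM ?permM ?qf.
Qed.

Canonical fiber_stab_group D := Group (group_set_fiber_stab D).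

Lemma tperm_fiber_stab D i j :
  i \in D -> j \in D -> f i = f j -> tperm i j \in fiber_stab D.
Proof.
move=> iD jD fij; apply/fiber_stabP; split=> [|k].
  by apply: fintype.subset_trans (tperm_on i j) _;
    rewrite finset.subUset !finset.sub1set iD jD.
by case: tpermP => [->|->|].
Qed.

Lemma fiber_stabD1 D n p : n \in D ->
  (p \in fiber_stab (D :\ n)) = (p \in fiber_stab D) && (p n == n).
Proof.
move=> nD; apply/fiber_stabP/andP => [[pD pf]|[/fiber_stabP[pD pf] pn]].
  split; last by apply/eqP/(out_perm pD); rewrite !inE eqxx.
  by apply/fiber_stabP; split=> //; apply: fintype.subset_trans pD
    (finset.subsetDl _ _).
split=> //; apply/fintype.subsetP => k pk; rewrite !inE (fintype.subsetP pD) //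
  andbT.
by apply: contraNneq pk => ->.
Qed.

(** Factor [p] as [p' * tperm i n] with [i = p n]: the permutation [p'] fixes
    [n], and [i] ranges over the points of the fibre of [n]. *)
Lemma big_fiber_stabD1 (V : nmodType) (F : {perm T} -> V) D n : n \in D ->
  \sum_(p in fiber_stab D) F p =
  \sum_(i in D | f i == f n) \sum_(p in fiber_stab (D :\ n)) F (p * tperm i
    n)%g.
Proof.
move=> nD.
rewrite (partition_big (fun p : {perm T} => p n)
  [pred i | (i \in D) && (f i == f n)]) /=; last first.
  by move=> p /fiber_stabP[pD pf]; rewrite perm_closed // nD pf eqxx.
apply: eq_bigr => i /andP[iD /eqP fi].
rewrite (reindex_inj (mulIg (tperm i n))) /=; apply: eq_bigl => p.
rewrite fiber_stabD1 // groupMr ?tperm_fiber_stab //; congr (_ && _).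
by rewrite permM -{2}(tpermR i n) (inj_eq perm_inj).
Qed.

Lemma big_fiber_stabD1l (V : nmodType) (F : {perm T} -> V) D n : n \in D ->
  \sum_(p in fiber_stab D) F p =
  \sum_(i in D | f i == f n) \sum_(p in fiber_stab (D :\ n)) F (tperm i n *
    p)%g.
Proof.
have invE (G : {perm T} -> V) E :
    \sum_(p in fiber_stab E) G p = \sum_(p in fiber_stab E) G p^-1%g.
  by rewrite (reindex_inj invg_inj) /=; apply: eq_bigl => p; rewrite groupV.
move=> nD; rewrite invE (big_fiber_stabD1 _ nD); apply: eq_bigr => i _.
by rewrite [RHS]invE; apply: eq_bigr => p _; rewrite invMg tpermV.
Qed.

End FiberStabilizer.

(** * Counting cycles *)
Section CycleCount.
Variable T : finType.
Implicit Types s u : {perm T}.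

Lemma card_porbits_mulC s u : #|porbits (s * u)%g| = #|porbits (u * s)%g|.
Proof.
have -> : (s * u = (u * s) ^ u)%g by rewrite conjgE -mulgA mulKg.
move: (u * s)%g => {}s.
have JE k : porbit (s ^ u) (u k) = u @: porbit s k.
  apply/finset.setP => j; apply/porbitP/imsetP =>
    [[m ->]|[_ /porbitP[m ->] ->]].
    exists ((s ^+ m)%g k); first exact: mem_porbit.
    by rewrite -conjXg conjgE !permM permK.
  by exists m; rewrite -conjXg conjgE !permM permK.
have -> : porbits (s ^ u) = (fun A : {set T} => u @: A) @: porbits s.
  apply/finset.setP => A; apply/imsetP/imsetP =>
    [[k _ ->]|[_ /imsetP[k _ ->] ->]].
    exists (porbit s (u^-1%g k)); first exact: imset_f.
    by rewrite -JE permKV.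
  by exists (u k).
by rewrite card_imset //; apply/imset_inj/perm_inj.
Qed.

(** The transposition inserts the fixed point [n] of [s] into the cycle of
    [i]. *)
Lemma card_porbits_mul_tperm s i n : s n = n -> i != n ->
  #|porbits (s * tperm i n)%g|.+1 = #|porbits s|.
Proof.
move=> sn in_; apply/eqP; rewrite card_porbits_mulC -(eqn_add2r 1).
have := porbits_mul_tperm s i n; rewrite in_ => <-.
have -> : i \notin porbit s n.
  apply: contra in_ => /porbitP[m ->].
  by elim: m => [|m IHm]; rewrite ?expg0 ?perm1 // expgS permM sn.
by rewrite addSnnS.
Qed.

End CycleCount.

(** * The signed cycle sum of a Young diagram *)
Lemma leq_card_inj_lt (T : finType) (A : {set T}) (f : T -> nat) m :
  {in A &, injective f} -> (forall i, i \in A -> (f i < m)%N) -> (#|A| <= m)%N.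
Proof.
move=> f_inj f_lt; rewrite cardE -(size_map f) -[leqRHS](size_iota 0).
apply: uniq_leq_size; first rewrite map_inj_in_uniq ?enum_uniq //.
  by move=> i j; rewrite !mem_enum; apply: f_inj.
by move=> _ /mapP[i + ->]; rewrite mem_enum mem_iota => /f_lt.
Qed.

Lemma card_enumerated (T : finType) (A : {set T}) (f : T -> nat) m :
  {in A &, injective f} -> (forall i, i \in A -> (f i < m)%N) ->
  (forall a, (a < m)%N -> exists2 i, i \in A & f i = a) -> #|A| = m.
Proof.
move=> f_inj f_lt f_onto; rewrite cardE -(size_map f) -[RHS](size_iota 0).
apply/perm_size/uniq_perm; rewrite ?iota_uniq ?map_inj_in_uniq ?enum_uniq //.
  by move=> i j; rewrite !mem_enum; apply: f_inj.
move=> a; rewrite mem_iota; apply/mapP/idP => [[i + ->]|/f_onto[i iA <-]].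
  by rewrite mem_enum; apply: f_lt.
by exists i; rewrite ?mem_enum.
Qed.

Section Diagram.
Variables (T : finType) (r c : T -> nat).

(** A filling of a Young diagram by the points of [T], encoded by the row [r] and
    the column [c] of the box that holds each point.  Smaller diagrams are then
    subsets of [T], so that corners can be removed inside one permutation group,
    and transposing the diagram only exchanges [r] and [c]. *)
Definition young_labels : Prop :=
  (forall i j, r i = r j -> c i = c j -> i = j) /\
  (forall k a b, (a <= r k)%N -> (b <= c k)%N ->
     exists m, r m = a /\ c m = b).

Hypothesis rcP : young_labels.

Section Pairing.
Variables (F : numFieldType) (G : {perm T} -> F) (D : {set T}).
Let C := fiber_stab c D.
Let R := fiber_stab r D.

(** When the point [m] stands at the crossing of the column of [i] and the row
    of [j], the terms cancel in pairs under [q -> q * tperm i m]: moving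
    [tperm i m] through [tperm i j] turns it into [tperm j m], which is absorbed
    by the sum over the row permutations, while the sign has changed. *)
Lemma signed_sum_tperm0 i j m : i \in D -> j \in D -> m \in D ->
  c m = c i -> r m = r j -> m != i -> m != j -> i != j ->
  \sum_(q in C) \sum_(p in R) (-1) ^+ odd_perm q * G (q * tperm i j * p)%g = 0.
Proof.
move=> iD jD mD cmi rmj mi mj ij; set S := \sum_(q in C) _.
suffices: S + S = 0 by rewrite -mulr2n => /eqP; rewrite mulrn_eq0 => /eqP.
have Cim : tperm i m \in C by apply: tperm_fiber_stab.
have Rjm : tperm j m \in R by apply: tperm_fiber_stab.
apply/eqP; rewrite addr_eq0 {1}/S (reindex_inj (mulIg (tperm i m))) /=.
rewrite -sumrN; apply/eqP; apply: eq_big => [q|q _]; first by rewrite groupMr.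
rewrite (reindex_inj (mulgI (tperm j m))) /= -sumrN.
apply: eq_big => [p|p _]; first by rewrite groupMl.
rewrite odd_permM odd_tperm eq_sym mi addbT signrN mulNr; congr (- (_ * G _)).
have -> : tperm j m = (tperm i m ^ tperm i j)%g.
  by rewrite tpermJ tpermL tpermD // eq_sym.
by rewrite conjgE tpermV !mulgA -(mulgA _ (tperm i j) (tperm i j)) tperm2 mulg1
  -(mulgA q (tperm i m) (tperm i m)) tperm2 mulg1.
Qed.
End Pairing.

Definition order_ideal (D : {set T}) : Prop :=
  forall k m, k \in D -> (r m <= r k)%N -> (c m <= c k)%N -> m \in D.

Definition cycle_sum (F : fieldType) (z : F) (D : {set T}) : F :=
  \sum_(q in fiber_stab c D) \sum_(p in fiber_stab r D)
    (-1) ^+ odd_perm q * z ^+ #|porbits (q * p)%g|.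

Definition corner (D : {set T}) (n : T) : Prop :=
  n \in D /\ forall k, k \in D -> (r n <= r k)%N -> (c n <= c k)%N -> k = n.

Lemma ex_corner (D : {set T}) : D != finset.set0 -> exists n, corner D n.
Proof.
case/finset.set0Pn => k0 k0D.
have [n nD max_n] := @arg_maxnP _ k0 (mem D) (fun k => r k + c k)%N k0D.
exists n; split=> // k kD rk ck; have := max_n k kD; have [rc_inj _] := rcP.
by move=> le_kn; apply: rc_inj; lia.
Qed.

Lemma order_ideal_corner (D : {set T}) n :
  order_ideal D -> corner D n -> order_ideal (D :\ n).
Proof.
move=> idD [nD nP] k m; rewrite !inE => /andP[kn kD] rm cm.
rewrite (idD k) // andbT; apply: contraNneq kn => mn.
by apply/eqP/nP => //; rewrite -mn.
Qed.

Lemma card_corner_row (D : {set T}) n : order_ideal D -> corner D n ->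
  #|[set i in D | (r i == r n) && (i != n)]| = c n.
Proof.
move=> idD [nD nP]; have [rc_inj rc_ex] := rcP; apply: (@card_enumerated _ _ c).
- move=> i j; rewrite !inE => /and3P[_ /eqP ri _] /and3P[_ /eqP rj _].
  by apply: rc_inj; rewrite ri rj.
- move=> i; rewrite !inE => /and3P[iD /eqP ri]; apply: contraNltn => le_ni.
  by apply/eqP/nP; rewrite ?ri.
move=> a lt_ac; have [m [rm cm]] := rc_ex n _ _ (leqnn _) (ltnW lt_ac).
exists m => //; rewrite !inE rm eqxx (idD n) ?rm ?cm ?(ltnW lt_ac) //=.
by apply: contraTneq lt_ac => mn; rewrite -cm mn ltnn.
Qed.
End Diagram.

Section CycleSum.
Variables (T : finType) (r c : T -> nat) (F : numFieldType) (z : F).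
Hypotheses (rcP : young_labels r c) (z0 : z != 0).

(** Write [q = q' * tperm j n] and [p = tperm i n * p'], with [j] in the column
    and [i] in the row of the corner [n], and [q'], [p'] fixing [n].  The term
    [i = j = n] gives the sum for the smaller diagram.  When exactly one of [i]
    and [j] differs from [n], the point [n] joins a cycle and the term is that
    sum divided by [z]; there are [c n] such terms with sign [+] and [r n] with
    sign [-].  When both differ from [n], the two transpositions multiply to
    [tperm i j * tperm j n], and the term vanishes by [signed_sum_tperm0]. *)
Lemma cycle_sum_corner (D : {set T}) n : order_ideal r c D -> corner r c D n ->
  cycle_sum r c z D =
  cycle_sum r c z (D :\ n) * (1 + ((c n)%:R - (r n)%:R) / z).
Proof.
move=> idD nP; have [nD n_max] := nP; have [rc_inj rc_ex] := rcP.
have rcP' : young_labels c r.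
  split=> [i j ci ri|k a b ak bk]; first exact: rc_inj.
  by have [m []] := rc_ex k b a bk ak; exists m.
have cardR : #|[set i in D | (r i == r n) && (i != n)]| = c n.
  exact: card_corner_row.
have cardC : #|[set i in D | (c i == c n) && (i != n)]| = r n.
  apply: (card_corner_row rcP') => [k m kD cm rm|]; first exact: idD rm cm.
  by split=> // k kD ck rk; apply: n_max.
(* Up to sign, [S (tperm j n * tperm i n)] collects the terms of [i] and [j]. *)
pose D' := D :\ n.
pose S (g : {perm T}) := \sum_(q in fiber_stab c D') \sum_(p in fiber_stab r D')
  (-1) ^+ odd_perm q * z ^+ #|porbits (q * g * p)%g|.
have step1 : cycle_sum r c z D = \sum_(j in D | c j == c n)
    \sum_(i in D | r i == r n) (-1) ^+ (j != n) * S (tperm j n * tperm i n)%g.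
  rewrite /cycle_sum (big_fiber_stabD1 _ _ nD); apply: eq_bigr => j _.
  under eq_bigr => q _ do rewrite (big_fiber_stabD1l _ _ nD).
  rewrite exchange_big /=; apply: eq_bigr => i _; rewrite mulr_sumr.
  apply: eq_bigr => q _; rewrite mulr_sumr; apply: eq_bigr => p _.
  by rewrite odd_permM odd_tperm signr_addb !mulgA mulrA [_ ^+ (j != n) *
    _]mulrC.
have S_tperm (g : {perm T}) k : g n = n -> k != n -> S (g * tperm k n)%g = S g
  / z.
  move=> gn kn; rewrite /S mulr_suml; apply: eq_bigr => q /fiber_stabP[qD' _].
  rewrite mulr_suml; apply: eq_bigr => p /fiber_stabP[pD' _].
  have nD' : n \notin D' by rewrite !inE eqxx.
  rewrite -mulrA; congr (_ * _).
  have -> : #|porbits (q * g * p)%g| = #|porbits (p * q * g * tperm k n)%g|.+1.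
    rewrite card_porbits_mul_tperm // ?(card_porbits_mulC _ p) ?mulgA //.
    by rewrite !permM (out_perm pD') // (out_perm qD').
  by rewrite exprSr mulfK // (card_porbits_mulC _ p) !mulgA.
have S1 : S 1%g = cycle_sum r c z D'.
  by apply: eq_bigr => q _; apply: eq_bigr => p _; rewrite mulg1.
have S_tperm2 i j : i \in D -> r i = r n -> i != n ->
    j \in D -> c j = c n -> j != n -> S (tperm j n * tperm i n)%g = 0.
  move=> iD ri iN jD cj jN.
  have ij : i != j by apply: contra_neq jN => ij; apply: rc_inj; rewrite // -ij.
  have -> : (tperm j n * tperm i n = tperm i j * tperm j n)%g.
    have -> : tperm i j = (tperm i n ^ tperm j n)%g.
      by rewrite tpermJ tpermR tpermD // eq_sym.
    by rewrite conjgE tpermV -!mulgA tperm2 mulg1.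
  rewrite S_tperm ?tpermD // 1?eq_sym //.
  have c_lt : (c i < c n)%N.
    by rewrite ltnNge; apply: contra iN => le_c; apply/eqP/n_max; rewrite ?ri.
  have r_lt : (r j < r n)%N.
    by rewrite ltnNge; apply: contra jN => le_r; apply/eqP/n_max; rewrite ?cj.
  (* [m] is the point in the row of [j] and the column of [i]. *)
  have [m [rm cm]] := rc_ex n _ _ (ltnW r_lt) (ltnW c_lt).
  have mi : m != i by apply: contraTneq r_lt => mi; rewrite -rm mi ri ltnn.
  have mj : m != j by apply: contraTneq c_lt => mj; rewrite -cm mj cj ltnn.
  have mn : m != n by apply: contraTneq c_lt => mn; rewrite -cm mn ltnn.
  have mD : m \in D by apply: (idD n); rewrite ?rm ?cm // ltnW.
  rewrite /S (@signed_sum_tperm0 _ r c _ (fun g => z ^+ #|porbits g|) D' i j m)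
    ?mul0r ?inE ?iN ?jN ?mn //.
rewrite step1 (bigD1 n) ?nD //= (bigD1 n) ?nD //=.
rewrite !eqxx /= !tperm1 !mulg1 expr0 mul1r S1 mulrDr mulr1 -addrA.
congr (_ + _).
rewrite (eq_bigr (fun=> cycle_sum r c z D' / z)); last first.
  by move=> i /andP[_ iN]; rewrite mul1r mul1g -[tperm i n]mul1g S_tperm ?perm1
    // S1.
rewrite [X in _ + X](eq_bigr (fun=> - (cycle_sum r c z D' / z))); last first.
  move=> j /andP[/andP[jD /eqP cj] jN]; rewrite (bigD1 n) ?nD ?eqxx //= jN.
  rewrite tperm1 mulg1 -[tperm j n]mul1g S_tperm ?perm1 // S1 expr1 mulN1r.
  rewrite big1 ?addr0 // => i /andP[/andP[iD /eqP ri] iN].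
  by rewrite mul1g S_tperm2 ?mulr0.
rewrite !sumr_const mulNrn.
have -> : #|[pred i | (i \in D) && (r i == r n) && (i != n)]| = c n.
  by rewrite -cardR; apply: eq_card => i; rewrite !inE andbA.
have -> : #|[pred i | (i \in D) && (c i == c n) && (i != n)]| = r n.
  by rewrite -cardC; apply: eq_card => i; rewrite !inE andbA.
rewrite -[_ *+ c n]mulr_natr -[_ *+ r n]mulr_natr.
by rewrite -mulrBr -!mulrA [z^-1 * _]mulrC.
Qed.

Lemma cycle_sumE (D : {set T}) : order_ideal r c D ->
  cycle_sum r c z D =
  z ^+ #|T| * \prod_(k in D) (1 + ((c k)%:R - (r k)%:R) / z).
Proof.
have [m] := ubnP #|D|; elim: m D => // m IHm D leDm idD.
have [->|/(ex_corner rcP)[n nP]] := eqVneq D finset.set0.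
  have stab0 (f : T -> nat) (V : nmodType) (G : {perm T} -> V) :
      \sum_(p in fiber_stab f finset.set0) G p = G 1%g.
    rewrite (big_pred1 1%g) // => p; apply/idP/eqP => [/fiber_stabP[p0 _]|->].
      by apply: perm_on_id p0 _; rewrite cards0.
    exact: group1.
  rewrite /cycle_sum !stab0 big_set0 odd_perm1 mul1r mulg1 mulr1.
  rewrite card_imset // => i j /eqP; rewrite eq_porbit_mem => /porbitP[e ->].
  by rewrite expg1n perm1.
have nD : n \in D by case: nP.
rewrite (cycle_sum_corner idD nP) IHm; last exact: order_ideal_corner idD nP.
  by rewrite [in RHS](big_setD1 n nD) /= [X in _ = _ * X]mulrC mulrA.
by rewrite (cardsD1 n) nD in leDm.
Qed.

(** The factors [z] accumulated for the fixed points turn each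
    [1 + (c k - r k) / z] into [z + (c k - r k)]. *)
Lemma cycle_sumT :
  cycle_sum r c z [set: T] = \prod_k (z + ((c k)%:R - (r k)%:R)).
Proof.
rewrite cycle_sumE; last by move=> k m; rewrite inE.
rewrite -cardsT -prodr_const -big_split /=; apply: eq_big => k; rewrite ?inE //.
by move=> _; rewrite mulrDr mulr1 mulrC divfK.
Qed.
End CycleSum.

(** * Von Neumann's lemma for the Young symmetrizer *)
Section VonNeumann.
Variables (T : finType) (r c : T -> nat).
Hypothesis rcP : young_labels r c.

(** If no two points of a column are sent by [g] to the same row, then the box
    at the crossing of the column of [i] and the row of [g i] always belongs to
    the diagram.  Otherwise let [a] be the row of [g i] for a bad [i].  In every
    column of height [h] at most [min (a, h)] points are sent to rows before
    [a], because they land in distinct rows, and exactly [min (a, h)] points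
    stand in rows before [a]; in the column of [i], where [h <= a], the first
    number is smaller as [i] is not counted.  Summing over the columns
    contradicts the bijectivity of [g]. *)
Lemma ex_sorted_box (g : {perm T}) :
  (forall i j, c i = c j -> r (g i) = r (g j) -> i = j) ->
  forall i, exists m, (r m == r (g i)) && (c m == c i).
Proof.
move=> g_inj i0; have [/existsP //|/existsPn no_m] :=
  boolP [exists m, (r m == r (g i0)) && (c m == c i0)].
have [rc_inj rc_ex] := rcP; pose a := r (g i0).
pose before f b := #|[set i | (f i < a)%N && (c i == b)]|.
have col_le b : (before (r \o g) b <= before r b)%N.
  have [/existsP[k /andP[/eqP ck ak]]|/existsPn no_k] :=
      boolP [exists k, (c k == b) && (a <= r k)%N].
    rewrite [leqRHS](@card_enumerated _ _ r a).
    - apply: (@leq_card_inj_lt _ _ (r \o g)) => [i j|i]; rewrite !inE.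
        by move=> /andP[_ /eqP ci] /andP[_ /eqP cj]; apply: g_inj;
          rewrite ci cj.
      by case/andP.
    - move=> i j; rewrite !inE => /andP[_ /eqP ci] /andP[_ /eqP cj] rij.
      by apply: rc_inj; rewrite // ci cj.
    - by move=> i; rewrite !inE => /andP[].
    move=> e lt_ea.
    have [m [rm cm]] := rc_ex k _ _ (leq_trans (ltnW lt_ea) ak) (leqnn _).
    by exists m; rewrite // !inE rm lt_ea cm ck /=.
  apply/subset_leq_card/fintype.subsetP => i; rewrite !inE => /andP[_ cib].
  by have := no_k i; rewrite cib -ltnNge andbT.
have col_lt : (before (r \o g) (c i0) < before r (c i0))%N.
  apply/proper_card/properP; split; last first.
    exists i0; rewrite !inE /= ?ltnn // eqxx andbT ltnNge.
    apply: contraL (isT) => le_a; have [m [rm cm]] :=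
      rc_ex i0 _ _ le_a (leqnn _).
    by have := no_m m; rewrite rm cm !eqxx.
  apply/fintype.subsetP => i; rewrite !inE => /andP[_ /eqP ci];
    rewrite ci eqxx andbT.
  rewrite ltnNge; apply: contraL (isT) => le_a.
  have [m [rm cm]] := rc_ex i _ _ le_a (leqnn _).
  by have := no_m m; rewrite rm cm ci !eqxx.
have [N c_le] : exists N, forall i, (c i <= N)%N.
  by exists (\max_i c i) => i; apply: leq_bigmax.
have col_sum f : (\sum_(b < N.+1) before f b)%N = #|[set i | (f i < a)%N]|.
  rewrite -[RHS]sum1_card (partition_big (fun i =>
    inord (c i) : 'I_N.+1) xpredT) //=.
  apply: eq_bigr => b _; rewrite /before -sum1_card; apply: eq_bigl => i.
  by rewrite !inE -val_eqE /= inordK // ltnS.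
have card_eq : #|[set i | ((r \o g) i < a)%N]| = #|[set i | (r i < a)%N]|.
  rewrite -(card_preimset [set i | (r i < a)%N] (@perm_inj _ g)).
  by apply: eq_card => i; rewrite !inE.
suffices : (#|[set i | ((r \o g) i < a)%N]| < #|[set i | (r i < a)%N]|)%N.
  by rewrite card_eq ltnn.
rewrite -!col_sum.
have lt_c : (c i0 < N.+1)%N by rewrite ltnS.
rewrite (bigD1 (Ordinal lt_c)) // [ltnRHS](bigD1 (Ordinal lt_c)) //=.
by rewrite -addSn leq_add // leq_sum.
Qed.

Let C := fiber_stab c [set: T].
Let R := fiber_stab r [set: T].

Lemma mem_fiber_stabT (f : T -> nat) (p : {perm T}) :
  (forall k, f (p k) = f k) -> p \in fiber_stab f [set: T].
Proof. by move=> pf; apply/fiber_stabP; split=> //;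
  apply/fintype.subsetP => k; rewrite inE. Qed.

(** Moving each point inside its column to the row of its image under [g] is a
    column permutation; what remains of [g] preserves rows. *)
Lemma col_row_factor (g : {perm T}) :
  (forall i j, c i = c j -> r (g i) = r (g j) -> i = j) ->
  exists2 q, q \in C & (q^-1 * g)%g \in R.
Proof.
move=> g_inj; have ex_m := ex_sorted_box g_inj; pose qf i := xchoose (ex_m i).
have qfP i : r (qf i) = r (g i) /\ c (qf i) = c i.
  by have /andP[/eqP-> /eqP->] := xchooseP (ex_m i).
have qf_inj : injective qf.
  move=> i j qij; have [ri ci] := qfP i; have [rj cj] := qfP j.
  by apply: g_inj; [rewrite -ci -cj qij | rewrite -ri -rj qij].
exists (perm qf_inj); apply: mem_fiber_stabT => k.
  by rewrite permE; case: (qfP k).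
by rewrite permM; have [<- _] := qfP ((perm qf_inj)^-1%g k);
  rewrite -(permE qf_inj) permKV.
Qed.

Section Equivariant.
Variable F : numFieldType.

Definition col_row_equivariant (w : {perm T} -> F) : Prop :=
  forall q p g, q \in C -> p \in R -> w (q * g * p)%g = (-1) ^+ odd_perm q * w
    g.

(** Either two points [i], [j] of a column are sent to the same row by [g], and
    then [tperm i j * g * tperm (g i) (g j) = g] forces [w g = - w g]; or [g] is
    the product of a column and a row permutation, and [w g] is [w 1] up to
    sign. *)
Lemma col_row_equivariant_eq0 w g :
  col_row_equivariant w -> w 1%g = 0 -> w g = 0.
Proof.
move=> wP w1; have [/existsP[i /existsP[j /and3P[ij /eqP cij /eqP rij]]]|inj] :=
    boolP [exists i, exists j, [&& i != j, c i == c j & r (g i) == r (g j)]].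
  have qC : tperm i j \in C by apply: tperm_fiber_stab; rewrite ?inE.
  have pR : tperm (g i) (g j) \in R by apply: tperm_fiber_stab; rewrite ?inE.
  have := wP _ _ g qC pR; rewrite -tpermJ conjgE !mulgA.
  rewrite -(mulgA _ g g^-1)%g mulgV mulg1 tperm2 mul1g odd_tperm ij mulN1r.
  by move/eqP; rewrite -addr_eq0 -mulr2n mulrn_eq0 => /eqP.
have [|q qC pR] := @col_row_factor g.
  move=> i j cij rij; apply: contraNeq inj => ij.
  by apply/existsP; exists i; apply/existsP; exists j; rewrite ij cij rij !eqxx.
by have := wP q _ 1%g qC pR; rewrite mulg1 mulKVg w1 mulr0.
Qed.

Definition young_coef (g : {perm T}) : F :=
  \sum_(q in C) \sum_(p in R) (-1) ^+ odd_perm q * (q * p == g)%g%:R.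

Lemma young_coef_equivariant : col_row_equivariant young_coef.
Proof.
move=> q0 p0 g q0C p0R; rewrite /young_coef (reindex_inj (mulgI q0)) mulr_sumr
  /=.
apply: eq_big => [q|q _]; first by rewrite groupMl.
rewrite (reindex_inj (mulIg p0)) mulr_sumr /=.
apply: eq_big => [p|p _]; first by rewrite groupMr.
rewrite odd_permM signr_addb -!mulrA; congr (_ * (_ * _)).
by rewrite -!mulgA (inj_eq (mulgI q0)) !mulgA (inj_eq (mulIg p0)).
Qed.

Lemma young_coef1 : young_coef 1%g = 1.
Proof.
rewrite /young_coef (bigD1 1%g) ?group1 //= (bigD1 1%g) ?group1 //=.
rewrite mulg1 eqxx odd_perm1 mulr1 big1 => [|p /andP[_ /negPf p1]]; last first.
  by rewrite mul1g p1 mulr0.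
rewrite addr0 big1 ?addr0 // => q /andP[/fiber_stabP[_ qc] q1].
rewrite big1 // => p /fiber_stabP[_ pr]; rewrite -eq_invg_mul.
case: eqP => [qp|]; last by rewrite mulr0.
case/eqP: q1; apply/permP => k; rewrite perm1; have [rc_inj _] := rcP.
by apply: rc_inj; rewrite // -{2}(permK q k) qp pr.
Qed.

Lemma col_row_equivariantE w g :
  col_row_equivariant w -> w g = w 1%g * young_coef g.
Proof.
move=> wP; apply/eqP; rewrite -subr_eq0; apply/eqP.
apply: (@col_row_equivariant_eq0 (fun h => w h - w 1%g * young_coef h)).
  move=> q p h qC pR; rewrite wP // young_coef_equivariant //.
  by rewrite mulrBr mulrCA.
by rewrite young_coef1 mulr1 subrr.
Qed.

Lemma sum_young_coef (V : lmodType F) (rho : {perm T} -> V) :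
  \sum_g young_coef g *: rho g =
  \sum_(q in C) \sum_(p in R) (-1) ^+ odd_perm q *: rho (q * p)%g.
Proof.
under eq_bigr => g _.
  rewrite /young_coef scaler_suml; under eq_bigr =>
    q _ do rewrite scaler_suml; over.
rewrite exchange_big; apply: eq_bigr => q _ /=.
rewrite exchange_big; apply: eq_bigr => p _ /=.
rewrite (bigD1 (q * p)%g) //= eqxx mulr1 big1 ?addr0 // => g.
by rewrite eq_sym => /negPf->; rewrite mulr0 scale0r.
Qed.

End Equivariant.
End VonNeumann.

(** * The cycle-counting element acts by contents *)
Section Convolution.
Variables (T : finType) (r c : T -> nat) (F : numFieldType).
Hypothesis rcP : young_labels r c.
Let y := young_coef r c F.

Definition content_prod (z : F) : F := \prod_k (z + ((c k)%:R - (r k)%:R)).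

Lemma sum_young_coef_cycles z : z != 0 ->
  \sum_g y g * z ^+ #|porbits g| = content_prod z.
Proof.
move=> z0; rewrite /content_prod -(cycle_sumT rcP z0).
exact: (sum_young_coef r c (V := F^o) (fun g => z ^+ #|porbits g|)).
Qed.

(** The convolution is equivariant because the number of cycles is a class
    function; its value at the identity is the signed cycle sum. *)
Lemma young_coef_conv_cycles z g : z != 0 ->
  \sum_h y h * z ^+ #|porbits (h^-1 * g)%g| = content_prod z * y g.
Proof.
move=> z0; pose w g := \sum_h y h * z ^+ #|porbits (h^-1 * g)%g|.
have wP : col_row_equivariant r c w.
  move=> q p x qC pR; rewrite /w mulr_sumr.
  rewrite (reindex_inj (mulgI q)) (reindex_inj (mulIg p)) /=.
  apply: eq_bigr => h _; rewrite mulrA mulgA -(young_coef_equivariant _ _ qC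
    pR).
  congr (_ * z ^+ _); rewrite !invMg -!mulgA mulKg.
  by rewrite card_porbits_mulC !mulgA mulgK.
rewrite -/(w g) (col_row_equivariantE rcP g wP); congr (_ * _).
rewrite -sum_young_coef_cycles // /w; apply: eq_bigr => h _.
by rewrite mulg1 porbitsV.
Qed.

(** This is the coefficient at [g] of [y x y], which inherits its equivariance
    from the outer two factors. *)
Lemma young_coef_conv_young (x g : {perm T}) :
  \sum_h y h * y ((h * x)^-1 * g)%g = (\sum_h y h * y (h * x)^-1%g) * y g.
Proof.
pose w g := \sum_h y h * y ((h * x)^-1 * g)%g.
have wP : col_row_equivariant r c w.
  move=> q p k qC pR; rewrite /w mulr_sumr (reindex_inj (mulgI q)) /=.
  apply: eq_bigr => h _; rewrite mulrA; congr (_ * _).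
    have := young_coef_equivariant F h qC (group1 _ : 1%g \in fiber_stab r _).
    by rewrite mulg1.
  have := young_coef_equivariant F ((h * x)^-1 * k)%g (group1 _ :
    1%g \in fiber_stab c _) pR.
  by rewrite odd_perm1 !mul1g mul1r -/y => <-; rewrite !invMg -!mulgA mulKg.
rewrite -/(w g) (col_row_equivariantE rcP g wP); congr (_ * _).
by apply: eq_bigr => h _; rewrite mulg1.
Qed.

Section Representation.
Variables (d : nat) (rG : mx_representation F [set: {perm T}]%G d).

Definition young_mx : 'M[F]_d := \sum_g y g *: rG g.

Lemma repr_mxMT g h : rG (g * h)%g = rG g *m rG h.
Proof. by rewrite repr_mxM ?inE. Qed.

Lemma young_mx_mul (a : {perm T} -> F) x :
  young_mx *m rG x *m (\sum_g a g *: rG g) =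
  \sum_g (\sum_h y h * a ((h * x)^-1 * g)%g) *: rG g.
Proof.
under [RHS]eq_bigr => g _ do rewrite scaler_suml.
rewrite exchange_big /= /young_mx !mulmx_suml; apply: eq_bigr => h _.
rewrite mulmx_sumr [RHS](reindex_inj (mulgI (h * x)%g)) /=;
  apply: eq_bigr => g _.
by rewrite mulKg !repr_mxMT -!scalemxAl -scalemxAr scalerA.
Qed.

Definition cycle_mx (z : F) : 'M[F]_d := \sum_g z ^+ #|porbits g| *: rG g.

Lemma cycle_mx_comm z x : cycle_mx z *m rG x = rG x *m cycle_mx z.
Proof.
rewrite mulmx_suml mulmx_sumr (reindex_inj (mulgI x)) /=.
rewrite [RHS](reindex_inj (mulIg x)) /=; apply: eq_bigr => g _.
by rewrite -scalemxAl -scalemxAr -!repr_mxMT mulgA card_porbits_mulC.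
Qed.

Lemma young_mx_cycle z : z != 0 ->
  young_mx *m cycle_mx z = content_prod z *: young_mx.
Proof.
move=> z0; rewrite -[young_mx in LHS]mulmx1 -(repr_mx1 rG) young_mx_mul.
rewrite scaler_sumr; apply: eq_bigr => g _.
by under eq_bigr => h _ do rewrite mulg1; rewrite young_coef_conv_cycles //
  scalerA.
Qed.

Lemma young_mx_sandwich x : exists k, young_mx *m rG x *m young_mx = k *:
  young_mx.
Proof.
exists (\sum_h y h * y (h * x)^-1%g); rewrite young_mx_mul scaler_sumr.
by apply: eq_bigr => g _; rewrite young_coef_conv_young scalerA.
Qed.

End Representation.
End Convolution.

(** The central element [cycle_mx rG z] multiplies the product by one scalar
    when it is absorbed on the left and by another when it is absorbed on the
    right. *)
Lemma young_mx_orthogonal (T : finType) (r1 c1 r2 c2 : T -> nat)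
    (F : numFieldType) (z : F) (d : nat)
    (rG : mx_representation F [set: {perm T}]%G d) x :
  young_labels r1 c1 -> young_labels r2 c2 -> z != 0 ->
  content_prod r1 c1 z != content_prod r2 c2 z ->
  young_mx r1 c1 rG *m rG x *m young_mx r2 c2 rG = 0.
Proof.
move=> rcP1 rcP2 z0 neq12; set Y1 := young_mx _ _ _; set Y2 := young_mx _ _ _.
have Y1P : Y1 *m cycle_mx rG z = content_prod r1 c1 z *: Y1 by apply:
  young_mx_cycle.
have Y2P : Y2 *m cycle_mx rG z = content_prod r2 c2 z *: Y2 by apply:
  young_mx_cycle.
have comm_Y1x : Y1 *m rG x *m cycle_mx rG z = content_prod r1 c1 z *:
  (Y1 *m rG x).
  by rewrite -mulmxA -cycle_mx_comm mulmxA Y1P scalemxAl.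
have comm_Y2 : Y2 *m cycle_mx rG z = cycle_mx rG z *m Y2.
  rewrite mulmx_suml mulmx_sumr; apply: eq_bigr => g _.
  by rewrite -scalemxAl -scalemxAr cycle_mx_comm.
have : content_prod r1 c1 z *: (Y1 *m rG x *m Y2) = content_prod r2 c2 z *:
  (Y1 *m rG x *m Y2).
  by rewrite scalemxAl -comm_Y1x -mulmxA -comm_Y2 Y2P scalemxAr.
move/eqP; rewrite -subr_eq0 -scalerBl scaler_eq0 subr_eq0 (negPf neq12).
by move/eqP.
Qed.

(** Summing over [g] first produces the coefficient at [x^-1] of
    [A_z y = omega(z) y]; the remaining sum over [x] is the signed cycle sum
    again, for [w]. *)
Lemma young_coef_cycle_pairing (T : finType) (r c : T -> nat) (F : numFieldType)
    (z w : F) : young_labels r c -> z != 0 -> w != 0 ->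
  \sum_g young_coef r c F g *
    \sum_x z ^+ #|porbits (g * x)%g| * w ^+ #|porbits x| =
  content_prod r c z * content_prod r c w.
Proof.
move=> rcP z0 w0; under eq_bigr => g _ do rewrite mulr_sumr.
rewrite exchange_big (reindex_inj invg_inj) /=.
rewrite -(sum_young_coef_cycles rcP w0) mulr_sumr; apply: eq_bigr => x _.
rewrite mulrA -(young_coef_conv_cycles rcP x z0) mulr_suml;
  apply: eq_bigr => g _.
by rewrite mulrA porbitsV -(porbitsV (g * _)%g) invMg invgK card_porbits_mulC.
Qed.

(** * Traces on ideals *)

(** In a rank factorization [A = C *m B], the hypothesis says that [B *m C] is
    the scalar matrix [k] of size [\rank A]. *)
Lemma mxtrace_quasi_idempotent (F : fieldType) n (A : 'M[F]_n) k :
  A *m A = k *: A -> \tr A = k * (\rank A)%:R.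
Proof.
move=> AA; move: (mulmx_base A) (col_base_full A) (row_base_free A).
move: (col_base A) (row_base A) => C B CB C_full B_free.
have BC : B *m C = k%:M.
  apply: (row_full_inj C_full); apply: (row_free_inj B_free) => /=.
  by rewrite mul_mx_scalar -scalemxAl CB -AA !mulmxA CB -mulmxA CB.
by rewrite -[in LHS]CB mxtrace_mulC BC mxtrace_scalar mulr_natr.
Qed.

Section RestrictedTrace.
Variables (F : fieldType) (n : nat) (U A : 'M[F]_n).

Lemma mxtrace_submod0 :
  (forall v : 'rV_n, (v <= U)%MS -> v *m A = 0) ->
  \tr (in_submod U (val_submod 1%:M *m A)) = 0.
Proof.
move=> UA0; suffices -> : val_submod (U := U) 1%:M *m A = 0 by rewrite linear0
  mxtrace0.
apply/row_matrixP => i; rewrite row_mul row0; apply: UA0.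
by rewrite (submx_trans (row_sub _ _)) // val_submod1.
Qed.

Lemma mxtrace_submod_rank1 (y : 'rV_n) k : y != 0 -> (y <= U)%MS ->
  y *m A = k *: y -> (forall v : 'rV_n, (v <= U)%MS -> (v *m A <= y)%MS) ->
  \tr (in_submod U (val_submod 1%:M *m A)) = k.
Proof.
move=> y0 yU yA Ay.
have /submxP[D DE] : (val_submod (U := U) 1%:M *m A <= y)%MS.
  apply/row_subP => i; rewrite row_mul; apply: Ay.
  by rewrite (submx_trans (row_sub _ _)) // val_submod1.
rewrite DE in_submodE -mulmxA -in_submodE mxtrace_mulC.
rewrite [_ *m D]mx11_scalar mxtrace_scalar mulr1n.
have : (in_submod U y *m D) *m y = k *: y.
  by rewrite -mulmxA -DE mulmxA -val_submodE in_submodK.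
rewrite [_ *m D]mx11_scalar mul_scalar_mx => /eqP.
rewrite -subr_eq0 -scalerBl scaler_eq0 (negPf y0) orbF subr_eq0.
by move=> /eqP <-; rewrite [LHS]mxE eqxx.
Qed.
End RestrictedTrace.

(** * The ideal generated by a Young symmetrizer *)
Section Specht.
Variables (T : finType) (F : numFieldType).
Let G := [set: {perm T}]%G.
Let aG := regular_repr F G.

Lemma gring_row_repr g : gring_row (aG g) = delta_mx 0 (gring_index G g).
Proof. by rewrite /gring_row rowK gring_indexK // mul1g. Qed.

Variables (r c : T -> nat).
Hypothesis rcP : young_labels r c.

Let Y := young_mx r c aG.
Definition young_row : 'rV[F]_#|G| := gring_row Y.
Let U := cyclic_mx aG young_row.

Lemma young_rowE : young_row = \sum_g young_coef r c F g *:
  delta_mx 0 (gring_index G g).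
Proof.
rewrite /young_row linear_sum; apply: eq_bigr => g _.
by rewrite linearZ /= gring_row_repr.
Qed.

Lemma young_row_neq0 : young_row != 0.
Proof.
apply/eqP => /rowP/(_ (gring_index G 1%g)); rewrite young_rowE summxE mxE =>
  /eqP.
rewrite (bigD1 1%g) //= big1 => [|g g1]; rewrite !mxE !eqxx /=; last first.
  rewrite -(inj_eq enum_val_inj) !gring_indexK ?inE // eq_sym (negPf g1).
  by rewrite mulr0.
by rewrite (young_coef1 rcP) addr0 mulr1 oner_eq0.
Qed.

(** The ideal generated by the symmetrizer is spanned by its translates. *)
Lemma cyclic_young_mulmx (A : 'M[F]_#|G|) m (W : 'M[F]_(m, #|G|)) :
  (forall x, gring_row (Y *m aG x *m A) <= W)%MS ->
  forall v : 'rV[F]_#|G|, (v <= U)%MS -> (v *m A <= W)%MS.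
Proof.
move=> YA v /cyclic_mxP[_ /envelop_mxP[a ->] ->].
rewrite mulmx_sumr mulmx_suml; apply: summx_sub => x _.
rewrite -scalemxAr -scalemxAl scalemx_sub //.
by rewrite /young_row -!gring_row_mul.
Qed.

Lemma young_row_mul k : Y *m Y = k *: Y -> young_row *m Y = k *: young_row.
Proof. by move=> YY; rewrite /young_row -gring_row_mul YY linearZ. Qed.

Lemma young_row_mul_repr g :
  young_row *m aG g = \sum_h young_coef r c F h *:
    delta_mx 0 (gring_index G (h * g)).
Proof.
rewrite /young_row -gring_row_mul mulmx_suml linear_sum; apply: eq_bigr => h _.
by rewrite -scalemxAl linearZ /= -repr_mxMT gring_row_repr.
Qed.

(** Let [L] be the multiplication [x -> y x] on the group algebra, whose row
    space is the ideal generated by [y].  All its diagonal entries are the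
    coefficient [1] of [y] at the identity, so its trace is [n!]; and
    [L *m L = k *: L]. *)
Lemma rank_specht k : Y *m Y = k *: Y -> k * (\rank U)%:R = (#|T|)`!%:R.
Proof.
move=> YY; pose L := enveloping_algebra_mx aG *m lin_mul_row young_row.
have rowL g : delta_mx 0 (gring_index G g) *m L = young_row *m aG g.
  by rewrite -rowE row_mul rowK mul_vec_lin_row gring_indexK ?inE.
have LL : L *m L = k *: L.
  apply/row_matrixP => i; rewrite -(gring_valK i); set g := enum_val i.
  rewrite [RHS]linearZ /= !rowE mulmxA rowL young_row_mul_repr mulmx_suml.
  under eq_bigr => h _ do rewrite -scalemxAl rowL repr_mxMT mulmxA scalemxAl
    scalemxAr.
  rewrite -mulmx_suml -mulmx_sumr -/(young_mx r c aG) -/Y.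
  by rewrite (young_row_mul YY) -young_row_mul_repr scalemxAl.
have -> : \rank U = \rank L by rewrite genmxE.
rewrite -(mxtrace_quasi_idempotent LL) /mxtrace.
have Lii i : L i i = 1.
  have -> : L i i = (row i L) 0 i by rewrite [RHS]mxE.
  rewrite rowE -[i in delta_mx _ i]gring_valK rowL young_row_mul_repr summxE.
  rewrite (bigD1 1%g) //= mul1g big1 => [|h h1].
    by rewrite gring_valK !mxE !eqxx (young_coef1 rcP) addr0 mulr1.
  rewrite !mxE eqxx /= -(inj_eq enum_val_inj) gring_indexK ?inE //.
  by rewrite -{1}[enum_val i]mul1g (inj_eq (mulIg _)) eq_sym (negPf h1) mulr0.
rewrite (eq_bigr (fun=> 1)) // sumr_const card_ord cardsT.
congr _%:R; rewrite -[in RHS]cardsT -card_perm; apply: eq_card => g.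
by rewrite inE; apply/esym/fintype.subsetP => i; rewrite inE.
Qed.
End Specht.

(** * Tableaux and contents *)
Section Tableau.
Variable n : nat.
Implicit Types l m : young n.

Definition row_label l (k : 'I_n) : nat := (tableau l k).1.
Definition col_label l (k : 'I_n) : nat := (tableau l k).2.

Lemma tableau_mem l k : tableau l k \in val l.
Proof. exact: enum_valP. Qed.

Lemma tableau_inj l : injective (tableau l).
Proof. by move=> i j /enum_val_inj/cast_ord_inj. Qed.

Lemma tableau_onto l b : b \in val l -> exists k, tableau l k = b.
Proof.
move=> bl; exists (cast_ord (esym (card_young l)) (enum_rank_in bl b)).
by rewrite /tableau cast_ordKV enum_rankK_in.
Qed.

Lemma young_closed l (b d : 'I_n * 'I_n) :
  b \in val l -> (d.1 <= b.1)%N -> (d.2 <= b.2)%N -> d \in val l.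
Proof.
case: l => A /= /andP[_ /forall_inP/[apply] /forallP/(_ d)/implyP Ad] d1 d2.
by apply: Ad; rewrite d1 d2.
Qed.

Lemma young_labels_tableau l : young_labels (row_label l) (col_label l).
Proof.
split=> [i j rij cij|k a b ak bk].
  apply: (@tableau_inj l); move: rij cij; rewrite /row_label /col_label.
  by case: (tableau l i) (tableau l j) => [? ?] [? ?] /= /val_inj-> /val_inj->.
have a_lt := leq_ltn_trans ak (ltn_ord _); have b_lt :=
  leq_ltn_trans bk (ltn_ord _).
have [e eE] : exists e, tableau l e = (Ordinal a_lt, Ordinal b_lt).
  by apply: tableau_onto; apply: young_closed (tableau_mem l k) _ _.
by exists e; rewrite /row_label /col_label eE.
Qed.

Lemma row_stabE l : row_stab l = fiber_stab (row_label l) [set: 'I_n].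
Proof.
apply/finset.setP => p; rewrite inE; apply/forallP/idP =>
  [pl|/fiber_stabP[_ pl] k].
  by apply: mem_fiber_stabT => k; rewrite /row_label (eqP (pl k)).
by apply/eqP/val_inj/pl.
Qed.

Lemma col_stabE l : col_stab l = fiber_stab (col_label l) [set: 'I_n].
Proof.
apply/finset.setP => p; rewrite inE; apply/forallP/idP =>
  [pl|/fiber_stabP[_ pl] k].
  by apply: mem_fiber_stabT => k; rewrite /col_label (eqP (pl k)).
by apply/eqP/val_inj/pl.
Qed.

Variable F : numFieldType.

Lemma content_prod_young l (z : F) :
  content_prod (row_label l) (col_label l) z =
  \prod_(b in val l) (z + (box_content b)%:~R).
Proof.
have -> : val l = [set tableau l k | k in [set: 'I_n]].
  apply/finset.setP => b; apply/idP/imsetP => [/tableau_onto[k <-]|[k _ ->]].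
    by exists k.
  exact: tableau_mem.
rewrite big_imset /=; last by move=> i j _ _; apply: tableau_inj.
apply: eq_big => [k|k _]; first by rewrite inE.
by rewrite /box_content rmorphB.
Qed.

Lemma leq_box_content (b d : 'I_n * 'I_n) :
  box_content d = box_content b -> (d.1 <= b.1)%N = (d.2 <= b.2)%N.
Proof. by case: b d => [b1 b2] [d1 d2]; rewrite /box_content /=; lia. Qed.

Definition diagonal l (d : int) : {set 'I_n * 'I_n} :=
  [set b in val l | box_content b == d].

(** The boxes of a diagram on a diagonal form an initial segment of it, so the
    segments of two diagrams are nested; a box of the first diagram missing from
    the second would make the inclusion strict. *)
Lemma young_eq_diagonal l m :
  (forall d, #|diagonal l d| = #|diagonal m d|) -> l = m.
Proof.
have sub l1 l2 : (forall d, #|diagonal l1 d| = #|diagonal l2 d|) ->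
    val l1 \subset val l2.
  move=> eq_diag; apply/fintype.subsetP => b bl1; apply: contraT => bNl2.
  suffices : (#|diagonal l2 (box_content b)| < #|diagonal l1 (box_content
    b)|)%N.
    by rewrite eq_diag ltnn.
  apply/proper_card/properP; split; last by exists b;
    rewrite !inE ?bl1 ?eqxx ?(negPf bNl2).
  apply/fintype.subsetP => d; rewrite !inE => /andP[dl2 db]; rewrite db andbT.
  have /orP[le_db|le_bd] := leq_total d.1 b.1.
    by apply: (young_closed bl1); rewrite -?(leq_box_content (eqP db)).
  case/negP: bNl2; apply: (young_closed dl2) => //.
  by rewrite -(leq_box_content (esym (eqP db))).
by move=> eq_diag; apply/val_inj/eqP; rewrite finset.eqEsubset !sub.
Qed.

(** As polynomials in [z] the two products agree at all positive integers, hence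
    have the same roots with multiplicities: the opposites of the contents. *)
Lemma content_prod_inj l m :
  (forall z : F, z != 0 ->
     \prod_(b in val l) (z + (box_content b)%:~R) =
     \prod_(b in val m) (z + (box_content b)%:~R)) -> l = m.
Proof.
move=> eq_lm; pose cs m0 :=
  [seq - (box_content b)%:~R : F | b <- enum (val m0)].
pose P m0 := \prod_(x <- cs m0) ('X - x%:P).
have PE m0 z : (P m0).[z] = \prod_(b in val m0) (z + (box_content b)%:~R).
  rewrite /P big_map horner_prod -big_enum /=; apply: eq_bigr => b _.
  by rewrite hornerXsubC opprK.
have PP : P l = P m.
  apply/eqP; rewrite -subr_eq0; apply/eqP.
  pose N := size (P l - P m); pose rs := [seq k.+1%:R : F | k <- iota 0 N].
  apply: (@roots_geq_poly_eq0 _ _ rs); last by rewrite size_map size_iota.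
    apply/allP => _ /mapP[k _ ->]; rewrite /root hornerD hornerN !PE.
    by rewrite eq_lm ?subrr ?pnatr_eq0.
  by rewrite map_inj_uniq ?iota_uniq // => i j /eqP; rewrite eqr_nat => /eqP[].
apply: young_eq_diagonal => d.
have/seq.permP/(_ (pred1 (- d%:~R))) := prod_XsubC_eq PP.
have cE m0 : count (pred1 (- d%:~R)) (cs m0) = #|diagonal m0 d|.
  rewrite count_map -sum1_count big_enum_cond /= -sum1_card.
  by apply: eq_bigl => b; rewrite !inE /= eqr_opp eqr_int.
by rewrite !cE.
Qed.

End Tableau.

(** * Specht characters at Young symmetrizers *)
Section SpechtCharacter.
Variables (n : nat) (F : numFieldType).
Implicit Types l m : young n.
Let G := [set: 'S_n]%G.
Let aG := regular_repr F G.
Let Y l := young_mx (row_label l) (col_label l) aG.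

Lemma young_symE l : young_sym F l = young_row F (row_label l) (col_label l).
Proof.
rewrite young_rowE (sum_young_coef _ _ (fun g => delta_mx 0 (gring_index G g))).
rewrite exchange_big /= /young_sym; apply: eq_big => [p|p _];
  first by rewrite row_stabE.
by apply: eq_bigl => q; rewrite col_stabE.
Qed.

(** The character of the Specht module of [m], extended linearly to the group
    algebra, at the Young symmetrizer of [l]. *)
Definition young_trace l m : F :=
  \sum_(q in col_stab l) \sum_(p in row_stab l)
    (-1) ^+ odd_perm q * irr_char F m (q * p)%g.

Lemma young_traceE l m :
  young_trace l m =
  \tr (in_submod (cyclic_mx aG (young_sym F m)) (val_submod 1%:M *m Y l)).
Proof.
rewrite /Y /young_mx mulmx_sumr !linear_sum /=.
transitivity (\sum_g young_coef (row_label l) (col_label l) F g *: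
  (irr_char F m g : F^o)).
  by rewrite sum_young_coef -row_stabE -col_stabE.
by apply: eq_bigr => g _; rewrite -scalemxAr !linearZ.
Qed.

Lemma young_trace_neq l m : l != m -> young_trace l m = 0.
Proof.
move=> neq_lm; rewrite young_traceE young_symE; apply: mxtrace_submod0 => v vU.
apply/eqP; rewrite -submx0.
apply: (cyclic_young_mulmx _ vU) => x.
have [z z0 neq_z] : exists2 z : F, z != 0 &
    content_prod (row_label m) (col_label m) z != content_prod (row_label l)
      (col_label l) z.
  apply: contrapT => no_z; case/eqP: neq_lm; apply:
    (@content_prod_inj _ F) => z z0.
  by rewrite -!content_prod_young; apply/eqP; apply/negPn/negP => neq_z;
    apply: no_z; exists z; rewrite // eq_sym.
rewrite (young_mx_orthogonal _ _ _ _ z0 neq_z) ?linear0 ?sub0mx //;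
  exact: young_labels_tableau.
Qed.

Lemma irr_dimE m : irr_dim F m = (\rank (cyclic_mx aG (young_sym F m)))%:R.
Proof. by rewrite /irr_dim /irr_char repr_mx1 mxtrace1. Qed.

(** The symmetrizer acts on its own ideal as an operator of rank one with image
    spanned by [y] itself, so its trace is the scalar [k] with [y y = k y]. *)
Lemma young_trace_dim l : young_trace l l * irr_dim F l = n`!%:R.
Proof.
have lP := young_labels_tableau l; pose Yl := Y l.
have [k YY] : exists k, Yl *m Yl = k *: Yl.
  have [k kP] := young_mx_sandwich lP aG 1%g.
  by exists k; rewrite -[in RHS]kP repr_mx1 mulmx1.
rewrite irr_dimE young_traceE young_symE -[n in RHS]card_ord -(rank_specht lP
  YY).
congr (_ * _); apply: mxtrace_submod_rank1.
- by apply: young_row_neq0 lP.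
- exact: cyclic_mx_id.
- exact: young_row_mul.
move=> v; apply: cyclic_young_mulmx => x.
by have [k' ->] := young_mx_sandwich lP aG x; rewrite linearZ scalemx_sub.
Qed.

End SpechtCharacter.

(** * The value of the character on [S(n)] *)
Lemma ncycles_lift n (u : 'S_n) :
  ncycles (lift_perm ord_max ord_max u) = (ncycles u).+1.
Proof.
set L := lift_perm _ _ _.
have LX m i : (L ^+ m)%g (lift ord_max i) = lift ord_max ((u ^+ m)%g i).
  by elim: m i => [|m IHm] i; rewrite ?expg0 ?perm1 // !expgS !permM
    lift_perm_lift.
have LXmax m : (L ^+ m)%g ord_max = ord_max.
  by elim: m => [|m IHm]; rewrite ?expg0 ?perm1 // expgS permM lift_perm_id.
have porbit_lift i : porbit L (lift ord_max i) = lift ord_max @: porbit u i.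
  apply/finset.setP => j; apply/porbitP/imsetP =>
    [[m ->]|[_ /porbitP[m ->] ->]].
    by exists ((u ^+ m)%g i); rewrite ?LX ?mem_porbit.
  by exists m; rewrite LX.
have porbit_max : porbit L ord_max = [set ord_max].
  apply/finset.setP => j; rewrite finset.in_set1;
    apply/porbitP/eqP => [[m ->]|->].
    exact: LXmax.
  by exists 0%N; rewrite perm1.
have -> : ncycles L = #|[set ord_max] |: (fun A : {set 'I_n} =>
  lift ord_max @: A) @: porbits u|.
  congr #|pred_of_set _|; apply/finset.setP => A; rewrite finset.in_setU1;
    apply/imsetP/orP => [[j _ ->]|[/eqP->|]].
  - have [i ->|->] := unliftP ord_max j; [right|left];
    last by rewrite porbit_max.
    by rewrite porbit_lift; apply: imset_f; apply: imset_f.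
  - by exists ord_max; rewrite ?porbit_max.
  by case/imsetP => _ /imsetP[i _ ->] ->; exists (lift ord_max i);
    rewrite ?porbit_lift.
rewrite cardsU1 card_imset; last exact/imset_inj/lift_inj.
rewrite (_ : _ \notin _) //; apply/imsetP => -[A _ /finset.setP/(_ ord_max)].
rewrite finset.in_set1 eqxx => /esym/imsetP[i _ /eqP].
by rewrite (negPf (neq_lift _ _)).
Qed.

Lemma ncycles_proj n (s : 'S_n.+1) :
  ncycles s = (ncycles (Defs.proj s) + (s ord_max == ord_max))%N.
Proof.
pose L := lift_perm ord_max ord_max (Defs.proj s).
have sE : s = (L * tperm (s ord_max) ord_max)%g.
  apply/permP => j; rewrite permM; have [i ->|->] := unliftP ord_max j;
    last first.
    by rewrite lift_perm_id tpermR.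
  rewrite lift_perm_lift projE /skip_max; case: eqP => [->|/eqP si].
    by rewrite tpermL.
  rewrite tpermD // eq_sym // (inj_eq perm_inj) eq_sym.
  by rewrite neq_lift.
have [smax|smax] := eqVneq (s ord_max) ord_max.
  by rewrite {1}sE smax tperm1 mulg1 ncycles_lift addn1.
apply/succn_inj; rewrite addn0 {1}sE -[in RHS]ncycles_lift.
by apply: card_porbits_mul_tperm; rewrite // lift_perm_id.
Qed.

(** Passing from level [m] to [m + 1] adds one cycle exactly when the new point
    is fixed; left and right translations by permutations that fix this point
    do not affect whether this happens. *)
Lemma cocycle_level x (g : Ginf) n : in_G n g ->
  cocycle x g = (ncycles (translate x g n))%:Z - (ncycles (vcoord x n))%:Z.
Proof.
have step m : in_G m g ->
    (ncycles (translate x g m.+1))%:Z - (ncycles (vcoord x m.+1))%:Z =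
    (ncycles (translate x g m))%:Z - (ncycles (vcoord x m))%:Z.
  move=> gm; rewrite (ncycles_proj (translate _ _ _)) (ncycles_proj (vcoord _
    _)).
  rewrite proj_translateE // proj_vcoord.
  have -> : (translate x g m.+1 ord_max == ord_max) = (vcoord x m.+1 ord_max ==
    ord_max).
    have [g1 g2] := gm; rewrite /translate !restrict_lift // lift_permV !permM.
    rewrite lift_perm_id.
    rewrite -[X in (_ == X) = _](lift_perm_id ord_max ord_max (Defs.restrict m
      g.2)^-1%g).
    by rewrite (inj_eq perm_inj).
  by rewrite !PoszD opprD addrACA subrr addr0.
move=> gn; have le_n : (level g <= n)%N.
  by rewrite /level; case: ex_minnP => m _; apply; apply/asboolP.
rewrite /cocycle vcoord_act; last exact: in_G_level.
rewrite -(subnKC le_n); elim: (n - level g)%N => [|k IHk];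
  first by rewrite addn0.
by rewrite addnS step ?IHk //; apply/in_G_level/leq_addr.
Qed.

Section Cylinders.
Local Open Scope classical_set_scope.

Lemma open_cylinder n (s : 'S_n) : open [set x : vperm | vcoord x n = s].
Proof.
have cont : continuous (fun x : vperm => vcoord x n : discrete_topology 'S_n).
  move=> x; apply: (@continuous_comp _ _ _ (fun x : vperm => \val x)
     (fun f : prod_topology (fun n => discrete_topology 'S_n) => f n)).
    exact: initial_continuous.
  exact: proj_continuous.
by move/continuousP : cont => /(_ [set s]); apply; apply: discrete_open.
Qed.

Lemma measurable_cylinder n (s : 'S_n) :
  measurable ([set x | vcoord x n = s] : set borel_vperm).
Proof. by apply: sub_sigma_algebra; apply: open_cylinder. Qed.

(** A function of the level [n] coordinate is a finite combination of indicators
    of cylinders. *)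
Lemma Rintegral_cylinder (R : realType) (mu : probability borel_vperm R) n
    (h : 'S_n -> R) :
  (\int[mu]_(x in [set: borel_vperm]) h (vcoord x n))%R =
  \sum_s h s * fine (mu [set x : vperm | vcoord x n = s]).
Proof.
rewrite /Rintegral.
have hE (x : borel_vperm) : (h (vcoord x n))%:E =
    (\sum_s (h s)%:E * (\1_[set y : vperm | vcoord y n = s] x)%:E)%E.
  rewrite (bigD1 (vcoord x n)) //= big1 => [|s sx].
    by rewrite indicE mem_set // mule1 adde0.
  by rewrite indicE memNset ?mule0 //= => xs; rewrite xs eqxx in sx.
under eq_integral => x _ do rewrite hE.
have int_indic s : mu.-integrable setT
    (fun x => (\1_[set y : vperm | vcoord y n = s] x)%:E).
  by apply: integrable_indic; apply: measurable_cylinder.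
have mu_fin s : mu [set x : vperm | vcoord x n = s] \is a fin_num.
  by apply: fin_num_measure; apply: measurable_cylinder.
rewrite integral_sum //; last by move=> s; apply: integrableZl.
rewrite (eq_bigr (fun s =>
    (h s * fine (mu [set x : vperm | vcoord x n = s]))%:E)).
  by rewrite sumEFin.
move=> s _; rewrite integralZl // integral_indic //;
  last exact: measurable_cylinder.
rewrite setIT EFinM; congr (_ * _)%E.
exact/esym/fineK/mu_fin.
Qed.
End Cylinders.

Section CharacterValue.
Variables (R : realType) (z : R[i]) (t : R) (mu : probability borel_vperm R).
Hypotheses (z0 : z != 0) (ht : t%:C = z * z^*) (hmu : is_ewens t mu).

Lemma cintegral_cylinder n (h : 'S_n -> R[i]) : (0 < n)%N ->
  cintegral mu (fun x => h (vcoord x n)) =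
  \sum_s h s * (t%:C ^+ ncycles s / rising t%:C n).
Proof.
move=> n0; pose w (s : 'S_n) : R := t ^+ ncycles s / rising t n.
have wE s : fine (mu [set x : vperm | vcoord x n = s]%classic) = w s.
  by rewrite hmu.
have sum_ReIm (a b : 'S_n -> R) :
    (\sum_s a s) +i* (\sum_s b s) = \sum_s (a s +i* b s).
  by elim: (index_enum _) => [|s r IHr]; rewrite ?big_nil // !big_cons -IHr.
rewrite /cintegral !(Rintegral_cylinder mu (fun s => _ (h s))) sum_ReIm.
apply: eq_bigr => s _; rewrite wE.
have <- : (w s)%:C = t%:C ^+ ncycles s / rising t%:C n.
  rewrite /w rmorphM fmorphV rmorphXn /rising rmorph_prod; congr (_ / _).
  by apply: eq_bigr => k _; rewrite rmorphD rmorph_nat.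
by case: (h s) => a b; simpc.
Qed.

Lemma chi_Sinf_of n (s : 'S_n) : (0 < n)%N ->
  chi mu z (Sinf_of s) =
  (\sum_x z ^+ ncycles (s * x)%g * z^* ^+ ncycles x) / rising t%:C n.
Proof.
move=> n0; pose g : Ginf := (Sinf_of s, Sinf1).
have gn : in_G n g by split=> i le_ni //=; apply: extend_ge.
have translateE x : translate x g n = (s * vcoord x n)%g.
  have -> : translate x g n = (Defs.restrict n (Sinf_of s) * vcoord x n *
    (Defs.restrict n Sinf1)^-1)%g by [].
  have -> : Defs.restrict n (Sinf_of s) = s.
    by apply/permP => i; apply/val_inj; rewrite /= restrictE /= ?extend_ord //;
      case: gn.
  have -> : Defs.restrict n Sinf1 = 1%g.
    by apply/permP => i; apply/val_inj; rewrite /= restrictE ?perm1.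
  by rewrite invg1 mulg1.
pose h (y : 'S_n) : R[i] := z ^+ ncycles (s * y)%g / z ^+ ncycles y.
have -> : chi mu z (Sinf_of s) = cintegral mu (fun x => h (vcoord x n)).
  rewrite /chi /spherical /inner; congr cintegral; apply/funext => x.
  rewrite /Trep /distinguished mul1r rmorph1 mulr1 (cocycle_level x gn)
    translateE.
  by rewrite expfzDr // -invr_expz.
rewrite (cintegral_cylinder h n0) mulr_suml; apply: eq_bigr => x _.
rewrite mulrA ht exprMn; congr (_ / _).
by rewrite -mulrA mulKf // expf_neq0.
Qed.

End CharacterValue.

(** * The coherent system *)
Theorem theorem4p1p1 (R : realType) (z : R[i]) (hz : z != 0)
    (t : R) (ht : t%:C = z * z^*)
    (mu : probability borel_vperm R) (hmu : is_ewens t mu)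
    (M : forall n : nat, young n -> R)
    (hM : is_coherent_system (chi mu z) M)
    (n : nat) (hn : (0 < n)%N) (lambda : young n) :
  (M n lambda)%:C =
    (\prod_(b in val lambda) `|z + (box_content b)%:~R| ^+ 2) / rising t%:C n *
    (irr_dim R[i] lambda ^+ 2 / n`!%:R).
Proof.
have [_ _ chiE] := hM n hn.
(* [S] is [chi_z], extended linearly, at the Young symmetrizer of [lambda]. *)
pose S := \sum_(q in col_stab lambda) \sum_(p in row_stab lambda)
  (-1) ^+ odd_perm q * chi mu z (Sinf_of (q * p)%g).
have trace_dim := young_trace_dim R[i] lambda.
have dim0 : irr_dim R[i] lambda != 0.
  apply/eqP => dim0; move/eqP: trace_dim; rewrite dim0 mulr0 eq_sym pnatr_eq0.
  by rewrite -leqn0 leqNgt fact_gt0.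
have S_trace : S = (M n lambda)%:C *
    (young_trace R[i] lambda lambda / irr_dim R[i] lambda).
  transitivity (\sum_(l : young n) (M n l)%:C *
      (young_trace R[i] lambda l / irr_dim R[i] l)).
    rewrite /S; under eq_bigr => q _.
      under eq_bigr => p _ do rewrite chiE mulr_sumr.
      rewrite exchange_big; over.
    rewrite exchange_big; apply: eq_bigr => l _ /=.
    rewrite /young_trace mulr_suml mulr_sumr; apply: eq_bigr => q _.
    rewrite mulr_suml mulr_sumr; apply: eq_bigr => p _.
    by rewrite mulrCA !mulrA.
  rewrite (bigD1 lambda) //= big1 ?addr0 // => l; rewrite eq_sym => neq_l.
  by rewrite young_trace_neq // mul0r mulr0.
have S_content : S =
    (\prod_(b in val lambda) `|z + (box_content b)%:~R| ^+ 2) / rising t%:C n.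
  have lP := young_labels_tableau lambda.
  have z0' : z^* != 0 by rewrite fmorph_eq0.
  have -> : \prod_(b in val lambda) `|z + (box_content b)%:~R| ^+ 2 =
      \prod_(b in val lambda) (z + (box_content b)%:~R) *
      \prod_(b in val lambda) (z^* + (box_content b)%:~R).
    rewrite -big_split; apply: eq_bigr => b _;
      rewrite normCK (rmorphD Num.conj).
    by congr (_ * (_ + _)); apply: rmorph_int.
  rewrite -!content_prod_young -(young_coef_cycle_pairing lP hz z0').
  rewrite mulr_suml.
  transitivity (\sum_g young_coef (row_label lambda) (col_label lambda) R[i] g
    *:
      (chi mu z (Sinf_of g) : R[i]^o)).
    by rewrite sum_young_coef -row_stabE -col_stabE.
  by apply: eq_bigr => g _; rewrite (chi_Sinf_of hz ht hmu _ hn) -mulrA.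
have fact_neq0 : n`!%:R != 0 :> R[i] by rewrite pnatr_eq0 -lt0n fact_gt0.
rewrite -S_content S_trace -trace_dim.
have trace0 : young_trace R[i] lambda lambda != 0.
  by apply: contra_neq fact_neq0 => tr0; rewrite -trace_dim tr0 mul0r.
by field; rewrite dim0.
Qed.
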